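(* Let $G$ be an embedded graph, let $\alpha,\beta,\gamma\in\mathbb{C}$, and let $k\in\mathbb{N}$. Then $$Q(G;(\alpha,\beta,\gamma),k)=\sum_{\phi\in\mathcal{K}(G_m,k)}(\alpha+\beta+\gamma)^{\mathrm{tot}(\phi)}\,\alpha^{\mathrm{wh}(\phi)}\,\beta^{\mathrm{bl}(\phi)}\,\gamma^{\mathrm{cr}(\phi)}.$$
   Context: An embedded graph is a graph (loops and multiple edges allowed, not necessarily connected) cellularly embedded in a closed, possibly non-orientable, surface, i.e. each component of the complement (each face) is an open disc; embedded graphs are considered up to homeomorphism of surfaces that carries one graph to the other. Equivalently, it is a ribbon graph. Medial graph: $G_m$ is the 4-regular graph embedded in the same surface obtained by placing a vertex $v_e$ on each edge $e$ of $G$ and drawing the edges of $G_m$ by following the face boundaries of $G$. An isolated vertex of $G$ contributes a free loop (a circular edge with no vertex), which counts as an edge of $G_m$. The canonical checkerboard colouring of $G_m$ colours black the faces of $G_m$ containing a vertex of $G$ and colours white the remaining faces (which correspond to the faces of $G$). At a vertex $v$ of $G_m$ let $h_1,h_2,h_3,h_4$ be the four incident half-edges in cyclic order, labelled so that the corners between $h_1,h_2$ and between $h_3,h_4$ are white, and the corners between $h_2,h_3$ and between $h_4,h_1$ are black. A vertex state at $v$ is a pairing of these half-edges (with the paired half-edges joined and $v$ removed): the white smoothing is $\{h_1,h_2\},\{h_3,h_4\}$, the black smoothing is $\{h_2,h_3\},\{h_4,h_1\}$, the crossing is $\{h_1,h_3\},\{h_2,h_4\}$. A graph state $s$ of $G_m$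 is a choice of vertex state at every vertex; it yields a collection of closed curves (including any free loops), and $c(s)$ is the number of these curves. $\mathcal{S}(G_m)$ is the set of graph states. Topological transition polynomial: for $\alpha,\beta,\gamma\in\mathbb{C}$, $Q(G;(\alpha,\beta,\gamma),t)=\sum_{s\in\mathcal{S}(G_m)}\omega(s)t^{c(s)}\in\mathbb{C}[t]$, where $\omega(s)$ is the product over vertices of $G_m$ of $\alpha$ for each white smoothing, $\beta$ for each black smoothing, and $\gamma$ for each crossing in $s$. $k$-valuations: a $k$-valuation of $G_m$ is a map $\phi:E(G_m)\to\{1,\dots,k\}$ (free loops are coloured too) such that for every colour $i$ and every vertex $v$ the number of $i$-coloured half-edges at $v$ is even. $\mathcal{K}(G_m,k)$ is the set of $k$-valuations. At a vertex $v$ of $G_m$, with the four incident half-edges $h_1,h_2,h_3,h_4$ in cyclic order, labelled so that the corners between $h_1,h_2$ and between $h_3,h_4$ are white and the corners between $h_2,h_3$ and between $h_4,h_1$ are black in the canonical checkerboard colouring, $\phi$ is of type: total, if all four half-edges have the same colour; and otherwise two distinct colours occur, each twice, and the type is white if $h_1,h_2$ have the same colour and $h_3,h_4$ have the same colour; black if $h_2,h_3$ have the same colour and $h_4,h_1$ have the same colour; crossing if $h_1,h_3$ have the same colour and $h_2,h_4$ have the same colour. $\mathrm{tot}(\phi),\mathrm{wh}(\phi),\mathrm{bl}(\phi),\mathrm{cr}(\phi)$ are the numbers of vertices of $G_m$ of total, white, black, crossing type. Convention: $0^0=1$; $\mathbb{N}$ denotes the positive integers. *)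

(* Defs.v *)
From HB Require Import structures.
From mathcomp Require Import all_boot all_order all_algebra.
From mathcomp Require Import reals complex.

Set Implicit Arguments.
Unset Strict Implicit.
Unset Printing Implicit Defensive.

Import Order.TTheory GRing.Theory Num.Theory.
Local Open Scope ring_scope.

(* The orbits of the group generated by two involutions f and g. *)
Definition components (T : finType) (f g : T -> T) : {set {set T}} :=
  [set [set y | connect (fun x z => (z == f x) || (z == g x)) x y] | x : T].

(* Embedded graphs as graph-encoded (generalised) maps.  A flag is a
   triangle of the barycentric subdivision: an end of an edge together with a
   side of that edge.  tau0, tau1, tau2 move to the adjacent triangle having
   the same edge and face, vertex and face, vertex and edge respectively.  Neither connectedness nor orientability is imposed.
   A component consisting of one vertex on a sphere has no flags, so isolated
   vertices are recorded separately. *)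
Record embedded_graph := EmbeddedGraph {
  flag : finType;
  isolated : finType;
  tau0 : flag -> flag;
  tau1 : flag -> flag;
  tau2 : flag -> flag;
  tau0K : involutive tau0;
  tau1K : involutive tau1;
  tau2K : involutive tau2;
  tau0_neq : forall x, tau0 x != x;
  tau1_neq : forall x, tau1 x != x;
  tau2_neq : forall x, tau2 x != x;
  tau02C : forall x, tau0 (tau2 x) = tau2 (tau0 x);
  tau02_neq : forall x, tau0 (tau2 x) != x }.

Definition edges (G : embedded_graph) : {set {set flag G}} :=
  [set [set x; tau0 x; tau0 (tau2 x); tau2 x] | x : flag G].

(* Non-isolated vertices, and faces of the components having an edge. *)
Definition vertices (G : embedded_graph) : {set {set flag G}} :=
  components (@tau1 G) (@tau2 G).
Definition faces (G : embedded_graph) : {set {set flag G}} :=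
  components (@tau0 G) (@tau1 G).

(* Checkerboard coloured 4-regular embedded graphs with free loops, described
   by their half-edges.  opp exchanges the two halves of an edge; wcorner h
   (resp. bcorner h) is the half-edge that bounds with h a white (resp. black)
   corner at their common vertex.  The cyclic order at a vertex is
   h, wcorner h, bcorner (wcorner h), bcorner h. *)
Record checkerboard_graph := CheckerboardGraph {
  half : finType;
  free_loop : finType;
  opp : half -> half;
  wcorner : half -> half;
  bcorner : half -> half;
  oppK : involutive opp;
  wcornerK : involutive wcorner;
  bcornerK : involutive bcorner;
  opp_neq : forall h, opp h != h;
  wcorner_neq : forall h, wcorner h != h;
  bcorner_neq : forall h, bcorner h != h;
  wbcornerC : forall h, wcorner (bcorner h) = bcorner (wcorner h);
  wbcorner_neq : forall h, wcorner (bcorner h) != h }.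

Section CheckerboardGraph.
Variable M : checkerboard_graph.
Implicit Type h : half M.

Definition star h : {set half M} :=
  [set h; wcorner h; bcorner (wcorner h); bcorner h].
Definition mvertices : {set {set half M}} := [set star h | h : half M].
Definition mvertex : finType := {v : {set half M} | v \in mvertices}.
Definition vertex_of h : mvertex := exist _ (star h) (imset_f star isT).

Definition link h : {set half M} := [set h; opp h].
Definition links : {set {set half M}} := [set link h | h : half M].
Definition medge : finType := ({e : {set half M} | e \in links} + free_loop M)%type.
Definition edge_of h : medge := inl (exist _ (link h) (imset_f link isT)).

Definition black_faces : {set {set half M}} := components (@opp M) (@bcorner M).
Definition white_faces : {set {set half M}} := components (@opp M) (@wcorner M).

Lemma card_star h : #|star h| = 4%N.
Proof.
rewrite /star -!setUA !cardsU1 cards1 !inE !negb_or.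
have hw := wcorner_neq h; have hb := bcorner_neq h.
have hx : bcorner (wcorner h) != h by rewrite -wbcornerC wbcorner_neq.
have wb : wcorner h != bcorner h.
  by apply: contra hx => /eqP->; rewrite bcornerK.
have wx : wcorner h != bcorner (wcorner h) by rewrite eq_sym bcorner_neq.
have xb : bcorner (wcorner h) != bcorner h.
  by rewrite (inj_eq (can_inj (@bcornerK M))).
by rewrite ![h == _]eq_sym hw hx hb wb wx xb.
Qed.

End CheckerboardGraph.

(* A flag of G is a corner of a face of G together with one of the two edge
   ends bounding that corner.  The medial edge running through the corner has two
   halves, one for each of these two ends, so medial half-edges are flags and
   the two halves of an edge are swapped by tau1.  Around v_e, the flags x and
   tau0 x lie on the same side of e, hence bound a white corner, whereas x and
   tau2 x lie at the same end of e, hence bound a black corner. *)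
Definition medial (G : embedded_graph) : checkerboard_graph :=
  @CheckerboardGraph (flag G) (isolated G) (@tau1 G) (@tau0 G) (@tau2 G)
    (@tau1K G) (@tau0K G) (@tau2K G) (@tau1_neq G) (@tau0_neq G) (@tau2_neq G)
    (@tau02C G) (@tau02_neq G).

Lemma medial_vertices (G : embedded_graph) : mvertices (medial G) = edges G.
Proof. by apply: eq_imset => x; rewrite /star /= -tau02C. Qed.

Lemma medial_black_faces (G : embedded_graph) :
  black_faces (medial G) = vertices G.
Proof. by []. Qed.

Lemma medial_white_faces (G : embedded_graph) :
  white_faces (medial G) = faces G.
Proof.
apply: eq_imset => x; apply/setP=> y; rewrite !inE.
by apply: eq_connect => u v; rewrite orbC.
Qed.

Variant vstate := WhiteSmoothing | BlackSmoothing | Crossing.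

Definition vstate_to_ord (s : vstate) : 'I_3 :=
  match s with
  | WhiteSmoothing => inord 0
  | BlackSmoothing => inord 1
  | Crossing => inord 2
  end.
Definition ord_to_vstate (i : 'I_3) : vstate :=
  match val i with
  | 0 => WhiteSmoothing
  | 1 => BlackSmoothing
  | _ => Crossing
  end%N.
Lemma vstate_to_ordK : cancel vstate_to_ord ord_to_vstate.
Proof. by case; rewrite /ord_to_vstate /= inordK. Qed.
HB.instance Definition _ := Finite.copy vstate (can_type vstate_to_ordK).

Section States.
Variable M : checkerboard_graph.

Definition gstate : finType := {ffun mvertex M -> vstate}.

Definition pairing (s : vstate) (h : half M) : half M :=
  match s with
  | WhiteSmoothing => wcorner h
  | BlackSmoothing => bcorner h
  | Crossing => bcorner (wcorner h)
  end.

Definition state_pairing (s : gstate) (h : half M) : half M :=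
  pairing (s (vertex_of h)) h.

(* Each curve other than a free loop is given by the half-edges it traverses. *)
Definition curves (s : gstate) : {set {set half M}} :=
  components (@opp M) (state_pairing s).
Definition ncurves (s : gstate) : nat := (#|curves s| + #|free_loop M|)%N.

Definition weight (K : comNzRingType) (a b c : K) (s : gstate) : K :=
  \prod_(v : mvertex M)
    match s v with
    | WhiteSmoothing => a
    | BlackSmoothing => b
    | Crossing => c
    end.

End States.

Definition transition_poly (K : comNzRingType) (G : embedded_graph)
    (a b c : K) : {poly K} :=
  \sum_(s : gstate (medial G)) weight a b c s *: 'X^(ncurves s).

Section Valuations.
Variables (M : checkerboard_graph) (k : nat).
Implicit Types (phi : {ffun medge M -> 'I_k}) (v : mvertex M).

Definition colour phi (h : half M) : 'I_k := phi (edge_of h).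

Definition valuations : {set {ffun medge M -> 'I_k}} :=
  [set phi : {ffun medge M -> 'I_k} |
    [forall i : 'I_k, forall v : mvertex M,
      ~~ odd #|[set h in val v | colour phi h == i]|]].

Definition is_total phi v : bool :=
  [forall h in val v, forall h' in val v, colour phi h == colour phi h'].
Definition is_white phi v : bool :=
  ~~ is_total phi v &&
  [forall h in val v, colour phi h == colour phi (wcorner h)].
Definition is_black phi v : bool :=
  ~~ is_total phi v &&
  [forall h in val v, colour phi h == colour phi (bcorner h)].
Definition is_crossing phi v : bool :=
  ~~ is_total phi v &&
  [forall h in val v, colour phi h == colour phi (bcorner (wcorner h))].

Definition tot phi : nat := #|[set v | is_total phi v]|.
Definition wh phi : nat := #|[set v | is_white phi v]|.
Definition bl phi : nat := #|[set v | is_black phi v]|.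
Definition cr phi : nat := #|[set v | is_crossing phi v]|.

End Valuations.

(* Main.v *)
(** For a fixed state [s], [k ^ c(s)] counts the colourings of the medial edges
    that are constant along every curve of [s].  Exchanging the sum over states
    with the sum over colourings, the inner sum over the states compatible with
    a colouring [phi] factors over the vertices.  The factor at [v] is
    [alpha + beta + gamma] if [phi] is total at [v], the weight of the only
    compatible smoothing if two colours occur twice each, and [0] if some
    colour occurs an odd number of times. *)

Require Import Defs.
From mathcomp Require Import all_boot all_order all_algebra.
From mathcomp Require Import reals complex.

Set Implicit Arguments.
Unset Strict Implicit.

Import GRing.Theory.
Local Open Scope ring_scope.
Local Open Scope complex_scope.

(** * Counting functions that are constant on fibres *)

Section FibrewiseConstant.
Variables (E C D : finType) (pi : E -> C).

(** Such functions factor uniquely through the surjection [pi], so composition with [pi] puts them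
    in bijection with the functions from [C] to [D]. A section [sigma] of [pi] recovers the
    factor. *)
Lemma card_fibrewise_constant :
  (forall c, exists x, pi x = c) ->
  #|[set phi : {ffun E -> D} |
      [forall x, forall y, (pi x == pi y) ==> (phi x == phi y)]]|
  = (#|D| ^ #|C|)%N.
Proof.
move=> pi_surj.
have sig_ex c : {x | pi x = c}.
  by have /sigW[x /eqP] : exists x, pi x == c;
    [have [x <-] := pi_surj c; exists x | exists x].
pose sigma c := sval (sig_ex c).
have sigmaK c : pi (sigma c) = c := svalP (sig_ex c).
pose lift (g : {ffun C -> D}) : {ffun E -> D} := [ffun x => g (pi x)].
have lift_inj : injective lift.
  by move=> g g' /ffunP eq_g; apply/ffunP=> c; move: (eq_g (sigma c));
    rewrite !ffunE sigmaK.
rewrite -card_ffun -(card_imset _ lift_inj); apply: eq_card => phi.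
rewrite inE; apply/idP/imsetP => [/forallP const_phi | [g _ ->]].
  exists [ffun c => phi (sigma c)] => //; apply/ffunP=> x; rewrite !ffunE.
  by apply/eqP; move/forallP: (const_phi x) => /(_ (sigma (pi x))) /implyP;
    apply; rewrite sigmaK.
by apply/forallP=> x; apply/forallP=> y; apply/implyP=> /eqP eq_pi;
  rewrite !ffunE eq_pi.
Qed.

End FibrewiseConstant.

(** * Orbits of two involutions *)

Section Components.
Variables (T : finType) (f g : T -> T).
Hypotheses (fK : involutive f) (gK : involutive g).

Definition step : rel T := fun x z => (z == f x) || (z == g x).
Definition component (x : T) : {set T} := [set y | connect step x y].

Lemma step_sym : symmetric step.
Proof.
by move=> x y; rewrite /step; congr (_ || _);
  apply/eqP/eqP=> ->; rewrite ?fK ?gK.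
Qed.

Lemma component_eq x y : (component x == component y) = connect step x y.
Proof.
have csym := sym_connect_sym step_sym.
apply/eqP/idP => [/setP/(_ y) | con_xy].
  by rewrite !inE connect0.
by apply/setP=> z; rewrite !inE (same_connect csym con_xy).
Qed.

Lemma connect_step_eq (D : eqType) (F : T -> D) :
  (forall x, F (f x) = F x) -> (forall x, F (g x) = F x) ->
  forall x y, connect step x y -> F x = F y.
Proof.
move=> Ff Fg x y /connectP[p + ->]; elim: p x => //= z p IHp x.
by case/andP=> /orP[]/eqP-> /IHp <-; rewrite ?Ff ?Fg.
Qed.

End Components.

(** With [p], [q], [r], [t] the colours met in cyclic order around a vertex, the disjuncts are the
    white, black and crossing pairings. Evenness forces [p] to recur, and the two remaining colours
    must then agree. *)
Lemma even_count4 (D : eqType) (p q r t : D) :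
  (forall i, ~~ odd (count_mem i [:: p; q; r; t])) <->
  [|| (p == q) && (r == t), (p == t) && (q == r) | (p == r) && (q == t)].
Proof.
split=> [even_c | ].
  move: (even_c p) (even_c q) (even_c r) => {even_c} /=.
  rewrite !eqxx (eq_sym q p) (eq_sym r p) (eq_sym t p).
  rewrite (eq_sym r q) (eq_sym t q) (eq_sym t r).
  case: (eqVneq p q) => [<-|/negPf npq]; case: (eqVneq p r) => [<-|/negPf npr];
  by case: (eqVneq p t) => [e|_]; rewrite -?e ?eqxx ?(eq_sym q p) ?npq //=;
    repeat case: (_ == _).
by case/or3P=> /andP[/eqP-> /eqP->] i /=; case: (_ == i); case: (_ == i).
Qed.

(** * Half-edges and pairings at a medial vertex *)

Section Checkerboard.
Variable M : checkerboard_graph.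
Implicit Types (h : Defs.half M) (v : mvertex M) (s : gstate M) (x : vstate).

Definition star_seq h : seq (Defs.half M) :=
  [:: h; wcorner h; bcorner (wcorner h); bcorner h].

Lemma mem_star h : star h =i star_seq h.
Proof. by move=> h'; rewrite !inE -!orbA. Qed.

Lemma uniq_star h : uniq (star_seq h).
Proof. by apply/card_uniqP; rewrite -(eq_card (mem_star h)) card_star. Qed.

Lemma forall_star h (P : pred (Defs.half M)) :
  [forall h' in star h, P h'] = all P (star_seq h).
Proof.
apply/forall_inP/allP => Pstar h'; have := Pstar h'; rewrite mem_star; exact.
Qed.

Lemma card_star_filter h (P : pred (Defs.half M)) :
  #|[set h' in star h | P h']| = count P (star_seq h).
Proof.
rewrite -size_filter -(card_uniqP (filter_uniq P (uniq_star h))).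
by apply: eq_card => h'; rewrite inE mem_filter mem_star andbC.
Qed.

Lemma mvertexP v : exists h, v = vertex_of h.
Proof.
by have /imsetP[h _ v_h] := valP v; exists h; apply: val_inj.
Qed.

(** A star is an orbit of the Klein four-group generated by the commuting involutions [wcorner] and
    [bcorner]. Since all stars have four elements, one inclusion is enough. *)
Lemma star_eq h h' : h' \in star h -> star h' = star h.
Proof.
move=> h'_h; apply/eqP; rewrite eqEcard !card_star leqnn andbT.
apply/subsetP=> z; move: h'_h; rewrite !mem_star !inE.
by case/or4P=> /eqP->; rewrite ?(wbcornerC, wcornerK, bcornerK);
  case/or4P=> /eqP->; rewrite eqxx ?orbT.
Qed.

Lemma vertex_of_pairing x h : vertex_of (pairing x h) = vertex_of h.
Proof.
apply: val_inj; apply: star_eq; rewrite mem_star !inE.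
by case: x; rewrite eqxx ?orbT.
Qed.

Lemma pairingK x : involutive (@pairing M x).
Proof.
by case: x => h /=; rewrite ?(wbcornerC, wcornerK, bcornerK).
Qed.

Lemma state_pairingK s : involutive (state_pairing s).
Proof. by move=> h; rewrite /state_pairing vertex_of_pairing pairingK. Qed.

Lemma edge_of_opp h : edge_of (Defs.opp h) = edge_of h.
Proof.
by congr inl; apply: val_inj; rewrite /= /link oppK setUC.
Qed.

Lemma medgeP (e : medge M) :
  (exists h, e = edge_of h) \/ (exists l, e = inr l).
Proof.
case: e => [e|l]; last by right; exists l.
by left; have /imsetP[h _ e_h] := valP e; exists h; congr inl; apply: val_inj.
Qed.

(** * Colourings compatible with a state *)

Section Colourings.
Variable k : nat.
Implicit Type phi : {ffun medge M -> 'I_k}.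

Definition compatible_at phi v x : bool :=
  [forall h in val v, colour phi h == colour phi (pairing x h)].
Definition compatible phi s : bool := [forall v, compatible_at phi v (s v)].

(** Colours sit on edges, so invariance under [opp] is automatic; invariance under [state_pairing s]
    then amounts to being constant along the curves of [s]. *)
Lemma compatibleP phi s :
  reflect (forall h, colour phi (state_pairing s h) = colour phi h)
          (compatible phi s).
Proof.
apply: (iffP forallP) => [comp h | comp v].
  have /forall_inP comp_h := comp (vertex_of h).
  by apply/esym/eqP/comp_h; rewrite mem_star mem_head.
apply/forall_inP=> h; have [h0 ->] := mvertexP v => h_h0.
have <- : vertex_of h = vertex_of h0 by apply: val_inj; apply: star_eq.
by rewrite -[pairing _ _]/(state_pairing s h) comp.
Qed.

(** The map [pi] sends a medial edge to the curve of [s] through it, a free loop being its own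
    curve. Compatible colourings are those constant on the fibres of [pi]. *)
Lemma card_compatible s :
  #|[set phi | compatible phi s]| = (k ^ ncurves s)%N.
Proof.
pose comp := component (@Defs.opp M) (state_pairing s).
have compE := component_eq (@oppK M) (state_pairingK s).
pose C : finType :=
  ({c : {set Defs.half M} | c \in curves s} + free_loop M)%type.
have comp_in h : comp h \in curves s by apply: imset_f.
pose toC h : C := inl (exist _ (comp h) (comp_in h)).
(* An edge is an unordered pair, so [pi] needs a chosen half. The choice is harmless: both halves
   lie on the same curve, as [pi_edge] records. *)
have half_of (l : {e : {set Defs.half M} | e \in links M}) : {h | val l = link h}.
  have /sigW[h /eqP] : exists h, val l == link h; last by exists h.
  by have /imsetP[h _ ->] := valP l; exists h.
pose pi (e : medge M) : C :=
  match e with inl l => toC (sval (half_of l)) | inr x => inr x end.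
have pi_edge h : pi (edge_of h) = toC h.
  congr inl; apply/val_inj/eqP; rewrite /= compE.
  case: (half_of _) => h' /= /setP/(_ h').
  rewrite !inE eqxx /= => /orP[]/eqP-> //.
  by apply: connect1; rewrite /step oppK eqxx.
have toC_eq h h' : (toC h == toC h') = connect (step (@Defs.opp M) (state_pairing s)) h h'.
  by rewrite -compE.
have pi_surj c : exists e, pi e = c.
  case: c => [c | l]; last by exists (inr l).
  have /imsetP[h _ c_h] := valP c.
  by exists (edge_of h); rewrite pi_edge; congr inl; apply: val_inj.
have := card_fibrewise_constant 'I_k pi_surj.
rewrite card_ord card_sum card_sig => <-.
apply: eq_card => phi; rewrite !inE.
apply/compatibleP/forallP => [comp_phi e | const_phi h]; last first.
  have /forallP/(_ (edge_of h))/implyP := const_phi (edge_of (state_pairing s h)).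
  rewrite !pi_edge toC_eq => /(_ _)/eqP; apply.
  by apply: connect1; rewrite /step state_pairingK eqxx orbT.
apply/forallP=> e'; apply/implyP.
case: (medgeP e) => [[h ->]|[l ->]]; case: (medgeP e') => [[h' ->]|[l' ->]];
  rewrite ?pi_edge ?toC_eq //; last by move=> /eqP[->].
move=> con; apply/eqP.
apply: (connect_step_eq _ comp_phi con) => h1.
by rewrite /colour edge_of_opp.
Qed.

(** Parity is a condition at each vertex separately, once the quantifiers over colours and vertices
    are swapped; there [even_count4] turns it into the existence of a colour-preserving pairing. *)
Lemma valuationE phi :
  (phi \in valuations M k) = [forall v, [exists x, compatible_at phi v x]].
Proof.
rewrite inE; transitivity [forall v : mvertex M, forall i,
    ~~ odd #|[set h in val v | colour phi h == i]|].
  by apply/forallP/forallP => ev a; apply/forallP=> b;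
    have /forallP := ev b; exact.
apply: eq_forallb => v; have [h ->] := mvertexP v.
have -> : [forall i, ~~ odd #|[set h' in star h | colour phi h' == i]|] =
    [forall i, ~~ odd (count_mem i (map (colour phi) (star_seq h)))].
  by apply: eq_forallb => i; rewrite card_star_filter count_map.
apply/forallP/existsP => [/even_count4 | [x comp_x]].
  case/or3P=> /andP[/eqP e1 /eqP e2];
    [exists WhiteSmoothing | exists BlackSmoothing | exists Crossing];
    by rewrite /compatible_at forall_star /= ?(wbcornerC, wcornerK, bcornerK)
      ?e1 ?e2 !eqxx.
apply/even_count4; move: comp_x; rewrite /compatible_at forall_star.
case: x => /=; rewrite ?(wbcornerC, wcornerK, bcornerK) => /and5P[-> h1 h2 h3 _];
  by rewrite ?h1 ?h2 ?h3 ?orbT.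
Qed.

Lemma is_total_star phi h :
  is_total phi (vertex_of h) = constant (map (colour phi) (star_seq h)).
Proof.
have -> : is_total phi (vertex_of h) =
    all (fun h1 => all (fun h2 => colour phi h1 == colour phi h2) (star_seq h))
      (star_seq h).
  by rewrite -forall_star; apply: eq_forallb => h1; rewrite -forall_star.
rewrite /= !eqxx /=; apply/idP/idP; first
  by case/and4P=> /and4P[/eqP<- /eqP<- /eqP<- _]; rewrite !eqxx.
by rewrite !andbT => /and3P[/eqP-> /eqP-> /eqP->]; rewrite !eqxx.
Qed.

Lemma total_compatible_at phi v x : is_total phi v -> compatible_at phi v x.
Proof.
move=> /forall_inP tot_v; apply/forall_inP => h v_h.
move/forall_inP: (tot_v h v_h); apply.
have [h0 v_h0] := mvertexP v; move: v_h; rewrite v_h0 /= => /star_eq <-.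
rewrite mem_star !inE.
by case: x; rewrite eqxx ?orbT.
Qed.

(** Any two distinct pairings among the three generate a group acting transitively on the four
    half-edges, so a colouring that respects both is constant at [v]. *)
Lemma compatible_at_total phi v x y :
  x != y -> compatible_at phi v x -> compatible_at phi v y -> is_total phi v.
Proof.
have [h ->] := mvertexP v; rewrite is_total_star /compatible_at !forall_star.
case: x; case: y; rewrite ?eqxx //= => _; rewrite ?(wbcornerC, wcornerK, bcornerK);
  by case/and5P=> /eqP e1 /eqP e2 /eqP e3 /eqP e4 _;
  case/and5P=> /eqP f1 /eqP f2 /eqP f3 /eqP f4 _; apply/and4P; split=> //=;
  apply/eqP; congruence.
Qed.

(** * Local weights and their product *)

Section Weights.
Variables (K : comNzRingType) (a b c : K).

Definition vweight x : K :=
  match x with WhiteSmoothing => a | BlackSmoothing => b | Crossing => c end.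

(** The finite structure on [vstate] is transported from ['I_3], so the sum is reindexed there and
    unfolded. *)
Lemma big_vstate (P : pred vstate) (F : vstate -> K) :
  \sum_(x | P x) F x =
    (if P WhiteSmoothing then F WhiteSmoothing else 0)
    + (if P BlackSmoothing then F BlackSmoothing else 0)
    + (if P Crossing then F Crossing else 0).
Proof.
have ord_to_vstateK : cancel ord_to_vstate vstate_to_ord.
  by move=> i; apply: val_inj; case: i => [[|[|[|]]]] //= lti;
    rewrite /ord_to_vstate /= inordK.
rewrite big_mkcond (reindex ord_to_vstate) /=; last first.
  by exists vstate_to_ord => i _; [apply: ord_to_vstateK | apply: vstate_to_ordK].
by rewrite !big_ord_recl big_ord0 addr0 addrA.
Qed.

(** One factor per type, equal to 1 when the type does not occur, so that the product over all
    vertices splits into four powers. *)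
Definition type_weight phi v : K :=
  (if is_total phi v then a + b + c else 1) *
  (if is_white phi v then a else 1) *
  (if is_black phi v then b else 1) *
  (if is_crossing phi v then c else 1).

(** At a total vertex all three states contribute; elsewhere [compatible_at_total] leaves only
    [x0]. *)
Lemma sum_compatible_at phi v :
  [exists x, compatible_at phi v x] ->
  \sum_(x | compatible_at phi v x) vweight x = type_weight phi v.
Proof.
case/existsP=> x0 comp_x0; rewrite /type_weight.
(* Each of the three non-total types is, by definition, compatibility with the matching vertex
   state. *)
rewrite -[is_white phi v]/(~~ is_total phi v && compatible_at phi v WhiteSmoothing).
rewrite -[is_black phi v]/(~~ is_total phi v && compatible_at phi v BlackSmoothing).
rewrite -[is_crossing phi v]/(~~ is_total phi v && compatible_at phi v Crossing).
have [tot_v | not_tot] := boolP (is_total phi v).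
  rewrite (eq_bigl xpredT) => [|x]; last by rewrite (total_compatible_at _ tot_v).
  by rewrite big_vstate /= !mulr1.
have comp_eq x : compatible_at phi v x = (x == x0).
  apply/idP/eqP => [comp_x | -> //]; apply/eqP; apply: contraNT not_tot => neq.
  exact: compatible_at_total neq comp_x comp_x0.
rewrite (eq_bigl _ _ comp_eq) big_pred1_eq !comp_eq /=.
by case: x0 {comp_x0 comp_eq}; do 3!case: eqP => // _; rewrite !(mul1r, mulr1).
Qed.

Lemma prod_type_weight phi :
  \prod_v type_weight phi v =
  (a + b + c) ^+ tot phi * a ^+ wh phi * b ^+ bl phi * c ^+ cr phi.
Proof.
rewrite !big_split /= -!big_mkcond !prodr_const.
by congr (_ ^+ _ * _ ^+ _ * _ ^+ _ * _ ^+ _);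
  apply: eq_card => v; rewrite inE.
Qed.

(** Compatible states are independent choices of a compatible vertex state at each vertex, so
    distributivity applies. *)
Lemma sum_compatible phi :
  \sum_(s | compatible phi s) weight a b c s =
  \prod_v \sum_(x | compatible_at phi v x) vweight x.
Proof.
rewrite bigA_distr_big_dep; apply: eq_big => [s | s _].
  by apply/forallP/familyP => comp v; have := comp v.
by apply: eq_bigr => v _; case: (s v).
Qed.

End Weights.
End Colourings.
End Checkerboard.

Theorem theorem4p3 (R : realType) (G : embedded_graph)
    (alpha beta gamma : R[i]) (k : nat) (k_gt0 : (0 < k)%N) :
  (transition_poly G alpha beta gamma).[k%:R] =
  \sum_(phi in valuations (medial G) k)
    (alpha + beta + gamma) ^+ tot phi * alpha ^+ wh phi * beta ^+ bl phi
      * gamma ^+ cr phi.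
Proof.
rewrite /transition_poly horner_sum.
transitivity (\sum_(s : gstate (medial G))
    \sum_(phi : {ffun medge (medial G) -> 'I_k} | compatible phi s)
      weight alpha beta gamma s).
  apply: eq_bigr => s _; rewrite hornerZ hornerXn sumr_const -natrX mulr_natr.
  by rewrite -card_compatible cardsE.
(* Both sides now run over all colourings, with the term 0 on the right for those that are not
   valuations. *)
rewrite (exchange_big_dep xpredT) //= [RHS]big_mkcond.
apply: eq_bigr => phi _; rewrite sum_compatible valuationE.
case: ifP => [/forallP val_phi | /forallPn[v /existsPn no_x]].
  rewrite -prod_type_weight; apply: eq_bigr => v _.
  exact: sum_compatible_at (val_phi v).
(* The local sum at [v] is empty, so its factor annihilates the product. *)
rewrite (bigD1 v) //= [X in X * _]big_pred0 ?mul0r // => x.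
exact: negbTE (no_x x).
Qed.
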